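(* Let $\Sigma$ be an oriented connected 2-manifold and let $(\mathcal Z,\widetilde{\mathcal Z})$ be a Ribaucour integrable pair of frontals $\Sigma\to\mathbb R^3$, with unit normals $\mathcal N,\widetilde{\mathcal N}$, Ribaucour data $(\rho,\phi)$ and corresponding frontal $\mathcal X_{\mathcal Z}$. Let $\widetilde\rho=\rho/\|\mathcal X_{\mathcal Z}\|^2$, $\widetilde\phi=\phi/\|\mathcal X_{\mathcal Z}\|^2$ (Ribaucour data of $(\widetilde{\mathcal Z},\mathcal Z)$) and let $\widetilde{\mathcal X}_{\widetilde{\mathcal Z}}=-\frac{\widetilde\rho}{\rho}\mathcal X_{\mathcal Z}$ be the corresponding frontal. Then the frontals $$\mathcal X^+:=\mathcal X_{\mathcal Z},\qquad\mathcal X^-:=\widetilde{\mathcal X}_{\widetilde{\mathcal Z}}$$ are the associated frontals of a frontal $\mathbf X:\Sigma\to\mathbb H^3$ with hyperbolic Gauss maps $\mathcal G_+=\Pi\circ\mathcal N$ and $\mathcal G_-=\Pi\circ\widetilde{\mathcal N}$, respectively.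
   Context: A smooth map $\mathcal Z:\Sigma\to\mathbb R^3$ is a frontal if there is a smooth $\mathcal N:\Sigma\to\mathbb S^2$ (its unit normal) with $\langle d\mathcal Z,\mathcal N\rangle=0$. Frontals $\mathcal Z,\widetilde{\mathcal Z}$ with unit normals $\mathcal N,\widetilde{\mathcal N}$ are envelopes of a congruence of spheres if there is a smooth $\tau:\Sigma\to\mathbb R$ with $\mathcal Z+\tau\mathcal N=\widetilde{\mathcal Z}+\tau\widetilde{\mathcal N}$. The pair is Ribaucour integrable if $\mathcal N\ne\widetilde{\mathcal N}$ everywhere, $\mathcal Z,\widetilde{\mathcal Z}$ are envelopes of a congruence of spheres, and $\Re\int_\gamma\frac{d\widetilde{\mathcal G}}{\widetilde{\mathcal G}-\mathcal G}=0$ for every loop $\gamma$ in $\Sigma$, where $\mathcal G=\Pi\circ\mathcal N$, $\widetilde{\mathcal G}=\Pi\circ\widetilde{\mathcal N}$, $\Pi:\mathbb S^2\to\mathbb C\cup\{\infty\}$ stereographic projection (understood by smooth extension where values are $\infty$; equivalently the smooth 1-form $\frac{\langle d\widetilde{\mathcal N},\mathcal N\rangle}{1-\langle\mathcal N,\widetilde{\mathcal N}\rangle}$ is exact). Ribaucour data are smooth functions $(\rho,\phi)$, $\rho$ nowhere zero, for which there is a frontal $\mathcal X_{\mathcal Z}$ with unit normal $\mathcal N$ satisfying $\rho=\langle\mathcal X_{\mathcal Z},\mathcal N\rangle$, $d\rho=\langle\mathcal X_{\mathcal Z},d\mathcal N\rangle$, $d\phi=\langle\mathcal X_{\mathcal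 Z},d\mathcal Z\rangle$, $\widetilde{\mathcal Z}=\mathcal Z-\frac{2\phi}{\|\mathcal X_{\mathcal Z}\|^2}\mathcal X_{\mathcal Z}$, $\widetilde{\mathcal N}=\mathcal N-\frac{2\rho}{\|\mathcal X_{\mathcal Z}\|^2}\mathcal X_{\mathcal Z}$. $\mathbb L^4=\mathbb R\times\mathbb R^3$ carries the metric $\ll(a,\mathbf p),(b,\mathbf q)\gg=-ab+\langle\mathbf p,\mathbf q\rangle$ and $\mathbb H^3=\{\mathbf r\in\mathbb L^4:\ll\mathbf r,\mathbf r\gg=-1\}$ (no sign condition on the first coordinate is imposed; the image of a connected $\Sigma$ lies in one of the two sheets). A smooth $\mathbf X=(r,\mathbf x):\Sigma\to\mathbb H^3$ is a frontal if it has a smooth unit normal $\mathbf N=(s,\mathbf n)$: $\ll\mathbf N,\mathbf N\gg=1$, $\ll\mathbf N,\mathbf X\gg=0$, $\ll d\mathbf X,\mathbf N\gg=0$. Then $r^2\neq s^2$, one writes $\mathbf X\pm\mathbf N=(r\pm s)(1,\mathcal N^\pm)$, the hyperbolic Gauss maps are $\mathcal G_\pm=\Pi\circ\mathcal N^\pm$, and the associated frontals of $\mathbf X$ are $\mathcal X^\pm=\mathbf x-\frac{r}{r\pm s}(\mathbf x\pm\mathbf n)$, with unit normals $\mathcal N^\pm$. *)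

(* Defs.v *)
From HB Require Import structures.
From mathcomp Require Import all_boot all_order all_algebra.
From mathcomp Require Import all_classical all_reals all_analysis.
From mathcomp Require Import ring.
From mathcomp Require Export complex.
Set Implicit Arguments.
Unset Strict Implicit.
Unset Printing Implicit Defensive.
Import Order.TTheory GRing.Theory Num.Theory numFieldNormedType.Exports.
Local Open Scope classical_set_scope.
Local Open Scope ring_scope.

(* Iterated directional derivatives in all directions; on an open subset [U] of
   a finite-dimensional [V] this is the usual C^k condition. *)
Fixpoint Ck_on (R : realType) (V W : normedModType R) (k : nat)
    (U : set V) (f : V -> W) : Prop :=
  (forall x, U x -> {for x, continuous f}) /\
  if k is k'.+1 then
    forall v : V, (forall x, U x -> derivable f x v) /\
                  Ck_on k' U (fun x => 'D_v f x)
  else True.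

Definition smooth_on (R : realType) (V W : normedModType R)
  (U : set V) (f : V -> W) : Prop := forall k, Ck_on k U f.

Record chart (R : realType) (M : topologicalType) := Chart {
  dom : set M;
  cod : set 'rV[R]_2;
  fwd : M -> 'rV[R]_2;
  bwd : 'rV[R]_2 -> M;
  dom_open : open dom;
  cod_open : open cod;
  fwd_cod : forall x, dom x -> cod (fwd x);
  bwd_dom : forall y, cod y -> dom (bwd y);
  fwdK : forall x, dom x -> bwd (fwd x) = x;
  bwdK : forall y, cod y -> fwd (bwd y) = y;
  fwd_continuous : forall x, dom x -> {for x, continuous fwd};
  bwd_continuous : forall y, cod y -> {for y, continuous bwd} }.

Definition overlap (R : realType) (M : topologicalType) (c1 c2 : chart R M) :
  set 'rV[R]_2 := [set y | cod c1 y /\ dom c2 (bwd c1 y)].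

Definition transition (R : realType) (M : topologicalType) (c1 c2 : chart R M) :
  'rV[R]_2 -> 'rV[R]_2 := fwd c2 \o bwd c1.

(* The orientation is the one defined by the (not necessarily maximal) atlas. *)
Record orientedSurface (R : realType) := OrientedSurface {
  carrier :> topologicalType;
  carrier_hausdorff : hausdorff_space carrier;
  carrier_second_countable : @second_countable carrier;
  atlas : set (chart R carrier);
  atlas_cover : forall x, exists2 c, atlas c & dom c x;
  atlas_smooth : forall c1 c2, atlas c1 -> atlas c2 ->
    smooth_on (overlap c1 c2) (transition c1 c2);
  atlas_oriented : forall c1 c2, atlas c1 -> atlas c2 ->
    forall y, overlap c1 c2 y -> 0 < \det ('J (transition c1 c2) y) }.

Definition smooth (R : realType) (S : orientedSurface R) (W : normedModType R)
  (f : S -> W) : Prop :=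
  forall c, atlas c -> smooth_on (cod c) (f \o bwd c).

Definition smooth_curve (R : realType) (S : orientedSurface R) (g : R -> S) :
  Prop :=
  continuous g /\
  forall c, atlas c -> smooth_on (g @^-1` dom c) (fwd c \o g).

(* A tangent vector, presented by its coordinates in some chart of the atlas.
   Different presentations of the same vector are not identified. *)
Record tvec (R : realType) (S : orientedSurface R) := Tvec {
  tchart : chart R S;
  tchart_atlas : atlas tchart;
  tpoint : 'rV[R]_2;
  tpoint_cod : cod tchart tpoint;
  tdir : 'rV[R]_2 }.

Definition foot (R : realType) (S : orientedSurface R) (v : tvec S) : S :=
  bwd (tchart v) (tpoint v).

Definition dmap (R : realType) (S : orientedSurface R) (W : normedModType R)
  (f : S -> W) (v : tvec S) : W :=
  'D_(tdir v) (f \o bwd (tchart v)) (tpoint v).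

Definition dot (R : realType) (u v : 'rV[R]_3) : R := \sum_i u 0 i * v 0 i.

(* Projection from the north pole (0, 0, 1); [None] is the point at infinity. *)
Definition stereo (R : realType) (n : 'rV[R]_3) : option R[i] :=
  let n0 := n 0 (inord 0) in let n1 := n 0 (inord 1) in
  let n2 := n 0 (inord 2) in
  if n2 == 1 then None else Some (Complex (n0 / (1 - n2)) (n1 / (1 - n2))).

(* [Z] is a frontal with unit normal [N]. *)
Definition frontal (R : realType) (S : orientedSurface R)
  (Z N : S -> 'rV[R]_3) : Prop :=
  [/\ smooth Z, smooth N, (forall p, dot (N p) (N p) = 1) &
      forall v : tvec S, dot (dmap Z v) (N (foot v)) = 0].

Definition envelopes (R : realType) (S : orientedSurface R)
  (Z N Zt Nt : S -> 'rV[R]_3) : Prop :=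
  exists2 tau : S -> R, smooth tau &
    forall p, Z p + tau p *: N p = Zt p + tau p *: Nt p.

Definition cderive (R : realType) (h : R -> R[i]) (t : R) : R[i] :=
  Complex ('D_1 (fun s => complex.Re (h s)) t)
          ('D_1 (fun s => complex.Im (h s)) t).

(* [Re \int d Gt / (Gt - G)] along a loop, [n] and [nt] being the restrictions
   of the two unit normals to the loop and [G], [Gt] their stereographic
   projections.  If [G] or [Gt] takes the value infinity on the loop, then the
   integrand is replaced by - <dNt, N> / (2 (1 - <N, Nt>)), which is smooth
   everywhere.  Where [G] and [Gt] are finite it is equal to
   Re (d Gt / (Gt - G)) - d (ln (1 + |Gt|^2)) / 2, because
   1 - <N, Nt> = 2 |Gt - G|^2 / ((1 + |G|^2) (1 + |Gt|^2)), so on a loop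
   along which both are finite the two integrals agree. *)
Definition gauss_period (R : realType) (n nt : R -> 'rV[R]_3) : R :=
  let g t := odflt 0 (stereo (n t)) in
  let gt t := odflt 0 (stereo (nt t)) in
  if `[< forall t, 0 <= t <= 1 -> stereo (n t) /\ stereo (nt t) >] then
    \int[lebesgue_measure]_(t in `[0, 1])
      complex.Re (cderive gt t / (gt t - g t))
  else
    - 2^-1 * \int[lebesgue_measure]_(t in `[0, 1])
      (dot ('D_1 nt t) (n t) / (1 - dot (n t) (nt t))).

Definition ribaucour_integrable (R : realType) (S : orientedSurface R)
  (Z N Zt Nt : S -> 'rV[R]_3) : Prop :=
  [/\ frontal Z N, frontal Zt Nt, (forall p, N p <> Nt p),
      envelopes Z N Zt Nt &
      forall g : R -> S, smooth_curve g -> g 0 = g 1 ->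
        gauss_period (N \o g) (Nt \o g) = 0].

(* [(rho, phi)] are Ribaucour data of the pair, with corresponding frontal
   [XZ]. *)
Definition ribaucour_data (R : realType) (S : orientedSurface R)
  (Z N Zt Nt : S -> 'rV[R]_3) (rho phi : S -> R) (XZ : S -> 'rV[R]_3) : Prop :=
  [/\ smooth rho /\ smooth phi, (forall p, rho p != 0), frontal XZ N,
      [/\ (forall p, rho p = dot (XZ p) (N p)),
          (forall v : tvec S, dmap rho v = dot (XZ (foot v)) (dmap N v)) &
          (forall v : tvec S, dmap phi v = dot (XZ (foot v)) (dmap Z v))] &
      (forall p,
         Zt p = Z p - (2 * phi p / dot (XZ p) (XZ p)) *: XZ p) /\
      (forall p,
         Nt p = N p - (2 * rho p / dot (XZ p) (XZ p)) *: XZ p)].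

Definition L4 (R : realType) : normedModType R := (R * 'rV[R]_3)%type.

Definition lorentz (R : realType) (a b : L4 R) : R :=
  - (a.1 * b.1) + dot a.2 b.2.

(* [X] is a frontal into the two-sheeted hyperboloid, with unit normal [N]. *)
Definition hyp_frontal (R : realType) (S : orientedSurface R)
  (X N : S -> L4 R) : Prop :=
  [/\ smooth X /\ smooth N,
      (forall p, lorentz (X p) (X p) = -1),
      (forall p, lorentz (N p) (N p) = 1),
      (forall p, lorentz (N p) (X p) = 0) &
      forall v : tvec S, lorentz (dmap X v) (N (foot v)) = 0].

(* In the next three definitions [e] is 1 or -1, for the upper or lower sign.
   The denominators do not vanish by [hyp_frontal_height_neq] below. *)

Definition hyp_normal (R : realType) (S : orientedSurface R) (e : R)
  (X N : S -> L4 R) (p : S) : 'rV[R]_3 :=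
  ((X p).1 + e * (N p).1)^-1 *: ((X p).2 + e *: (N p).2).

Definition hyp_gauss (R : realType) (S : orientedSurface R) (e : R)
  (X N : S -> L4 R) (p : S) : option R[i] :=
  stereo (hyp_normal e X N p).

Definition associated (R : realType) (S : orientedSurface R) (e : R)
  (X N : S -> L4 R) (p : S) : 'rV[R]_3 :=
  (X p).2 - ((X p).1 / ((X p).1 + e * (N p).1)) *: ((X p).2 + e *: (N p).2).

Lemma dot_eq0 (R : realType) (u : 'rV[R]_3) : dot u u = 0 -> u = 0.
Proof.
move=> /eqP; rewrite psumr_eq0 => [/allP h|i _]; last by rewrite -expr2 sqr_ge0.
apply/rowP => i; rewrite mxE.
by have /(_ (mem_index_enum i)) := h i; rewrite /= mulf_eq0 orbb => /eqP.
Qed.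

Lemma hyp_frontal_height_neq (R : realType) (S : orientedSurface R)
    (X N : S -> L4 R) (e : R) (p : S) : e ^+ 2 = 1 -> hyp_frontal X N ->
  (X p).1 + e * (N p).1 != 0.
Proof.
move=> e1 [_ /(_ p) hX /(_ p) hN /(_ p) hNX _]; apply/eqP => h0.
have hr : (X p).1 = - (e * (N p).1) by apply/eqP; rewrite -addr_eq0 h0.
have dotE (u v : 'rV[R]_3) :
    dot (u + e *: v) (u + e *: v) = dot u u + 2 * e * dot v u + e ^+ 2 * dot v v.
  rewrite /dot !mulr_sumr -!big_split /=; apply: eq_bigr => i _.
  by rewrite !mxE !expr2; ring.
have /dot_eq0 hx : dot ((X p).2 + e *: (N p).2) ((X p).2 + e *: (N p).2) = 0.
  move: hX hN hNX; rewrite /lorentz dotE hr => hX hN hNX.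
  have -> : dot (X p).2 (X p).2 = e ^+ 2 * (N p).1 ^+ 2 - 1.
    by move: hX; rewrite expr2 => /eqP; rewrite addrC subr_eq => /eqP ->; ring.
  have -> : dot (N p).2 (X p).2 = - (e * (N p).1 ^+ 2).
    by move/eqP: hNX; rewrite addrC subr_eq add0r => /eqP ->; ring.
  have -> : dot (N p).2 (N p).2 = 1 + (N p).1 ^+ 2.
    by move/eqP: hN; rewrite addrC subr_eq => /eqP ->; ring.
  by rewrite e1; ring: e1.
have hx2 : (X p).2 = - e *: (N p).2.
  by apply/eqP; rewrite scaleNr -addr_eq0 hx.
have : lorentz (X p) (X p) = e ^+ 2 * lorentz (N p) (N p).
  rewrite /lorentz hr hx2 /dot mulrDr mulr_sumr; congr (_ + _); first by ring.
  by apply: eq_bigr => i _; rewrite !mxE; ring.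
rewrite hX hN e1 mulr1 => /eqP.
by rewrite eq_sym -addr_eq0 (pnatr_eq0 _ 2).
Qed.

(* Main.v *)
From HB Require Import structures.
Require Import Defs.
From mathcomp Require Import all_boot all_order all_algebra.
From mathcomp Require Import all_classical all_reals all_analysis.
From mathcomp Require Import ring.
Set Implicit Arguments.
Unset Strict Implicit.
Unset Printing Implicit Defensive.
Import GRing.Theory Num.Theory numFieldNormedType.Exports.
Local Open Scope classical_set_scope.
Local Open Scope ring_scope.

(* Put q = |XZ|^2, rhot = rho / q and w = XZt = - XZ / q.  The formulas for Zt
   and Nt become Zt = Z + 2 phi w and Nt = N + 2 rho w, which yield the swapped
   data by the Leibniz rule.  The requirement X + Nu = a (1, N),
   X - Nu = b (1, Nt) with associated frontals XZ and w forces a = - 1 / rho and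
   b = - 1 / rhot.  Conversely, as <N, Nt> = 1 - 2 rho rhot, these choices give
   <<X, X>> = - <<Nu, Nu>> = -1 and <<X, Nu>> = 0, and <<dX, Nu>> = 0 follows
   from <dN, Nt> = - 2 rhot d rho and <dNt, N> = - 2 rho d rhot. *)

(** * Directional derivatives of scalar multiples and of linear images *)

Section directional_derivative.
Context {R : realType} {V W W' : normedModType R}.

(** The difference quotient splits as [f (h *: v + x)] times the quotient of [g], plus the quotient
    of [f] times [g x]. *)
Lemma is_derive_scale (f : V -> R) (g : V -> W) (x v : V) (df : R) (dg : W) :
  is_derive x v f df -> is_derive x v g dg ->
  is_derive x v (fun y => f y *: g y) (f x *: dg + df *: g x).
Proof.
move=> [fx <-] [gx <-].
have h : h^-1 *: (f (h *: v + x) *: g (h *: v + x) - f x *: g x) @[h --> 0^']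
    --> f x *: 'D_v g x + 'D_v f x *: g x.
  rewrite [X in X @ _](_ : _ = fun h =>
      f (h *: v + x) *: (h^-1 *: (g (h *: v + x) - g x)) +
      (h^-1 *: (f (h *: v + x) - f x)) *: g x); last first.
    apply/funext => h; rewrite [X in _ = X + _]scalerA [_ * h^-1]mulrC.
    rewrite -[X in _ = X + _]scalerA -[X in _ = _ + X]scalerA -scalerDr.
    by congr (_ *: _); rewrite scalerBr scalerBl addrA subrK.
  apply: cvgD; last by apply: cvgZ; [exact: fx|exact: cvg_cst].
  apply: cvgZ; last exact: gx.
  (* Derivability in the single direction [v] gives continuity along the line through [x], which is
     all that the limit in [h] uses. *)
  have : {for 0, continuous (fun h : R => f (h *: v + x))}.
    exact/differentiable_continuous/derivable1_diffP/(derivable1P _ _ _).1.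
  by move=> /continuous_withinNx; rewrite scale0r add0r.
by apply: DeriveDef; [apply/cvg_ex; eexists; exact: h|apply: cvg_lim h].
Qed.

Lemma is_derive_linear (L : {linear W -> W'}) (f : V -> W) (x v : V) (df : W) :
  continuous L -> is_derive x v f df ->
  is_derive x v (fun y => L (f y)) (L df).
Proof.
move=> Lc [fx <-].
have h : h^-1 *: (L (f (h *: v + x)) - L (f x)) @[h --> 0^'] --> L ('D_v f x).
  rewrite [X in X @ _](_ : _ = L \o
      (fun h => h^-1 *: (f (h *: v + x) - f x))); last first.
    by apply/funext => h; rewrite -(linearB L) -linearZZ.
  apply: cvg_comp; [exact: fx|exact: Lc].
by apply: DeriveDef; [apply/cvg_ex; eexists; exact: h|apply: cvg_lim h].
Qed.

End directional_derivative.

(** * The C^k condition on an open set *)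

Section Ck.
Context {R : realType} {V : normedModType R} (U : set V) (oU : open U).
Context {W : normedModType R}.

Lemma Ck_on_continuous k (f : V -> W) : Ck_on k U f ->
  forall x, U x -> {for x, continuous f}.
Proof. by case: k => [|k] []. Qed.

(** Since [U] is open, equality on [U] is equality near each of its points, so limits and
    directional derivatives agree there. The induction is over all pairs, because the derivatives
    form the next pair. *)
Lemma eq_Ck_on k (f g : V -> W) : (forall x, U x -> f x = g x) ->
  Ck_on k U f -> Ck_on k U g.
Proof.
have nearE (f' g' : V -> W) x : (forall y, U y -> f' y = g' y) -> U x ->
    \near x, f' x = g' x.
  by move=> e Ux; apply: filterS (open_nbhs_nbhs (conj oU Ux)).
elim: k f g => [|k ih] f g fg [fc fd]; split.
- move=> x Ux; suff : g @ x --> f x by rewrite fg.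
  exact: cvg_trans (near_eq_cvg (nearE _ _ _ fg Ux)) (fc x Ux).
- by [].
- move=> x Ux; suff : g @ x --> f x by rewrite fg.
  exact: cvg_trans (near_eq_cvg (nearE _ _ _ fg Ux)) (fc x Ux).
- move=> v; have [df Cf] := fd v; split=> [x Ux|].
    exact: near_eq_derivable (nearE _ _ _ fg Ux) (df x Ux).
  by apply: ih Cf => x Ux; exact: near_eq_derive (nearE _ _ _ fg Ux).
Qed.

(** This lets an explicit formula [g], correct only on [U], stand in for the globally defined
    ['D_v f]. *)
Lemma Ck_onSP k (f : V -> W) : (forall x, U x -> {for x, continuous f}) ->
  (forall v, exists2 g, (forall x, U x -> is_derive x v f (g x))
    & Ck_on k U g) ->
  Ck_on k.+1 U f.
Proof.
move=> fc fd; split => // v; have [g fg Cg] := fd v; split=> [x /fg[]//|].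
by apply: eq_Ck_on Cg => x /fg[].
Qed.

Lemma Ck_onS_is_derive k (f : V -> W) x v : Ck_on k.+1 U f -> U x ->
  is_derive x v f ('D_v f x).
Proof. by move=> [_ /(_ v)[fd _]] /fd /derivableP. Qed.

Lemma Ck_onW k (f : V -> W) : Ck_on k.+1 U f -> Ck_on k U f.
Proof.
elim: k f => [|k ih] f [fc fd]; first by split.
by split => // v; have [df Cf] := fd v; split => //; exact: ih.
Qed.

End Ck.

(** * Closure of the C^k condition under sums, linear images, products and inverses *)

Section Ck_operations.
Context {R : realType} {V : normedModType R} (U : set V) (oU : open U).
Context {W W' : normedModType R}.

Lemma Ck_on_cst k (w : W) : Ck_on k U (fun _ : V => w).
Proof.
elim: k w => [|k ih] w; first by split=> // x _; exact: cvg_cst.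
apply: Ck_onSP => // [x _|v]; first exact: cvg_cst.
by exists (fun=> 0) => // x _; exact: is_derive_cst.
Qed.

Lemma Ck_onD k (f g : V -> W) : Ck_on k U f -> Ck_on k U g ->
  Ck_on k U (fun x => f x + g x).
Proof.
elim: k f g => [|k ih] f g Cf Cg.
  split=> // x Ux.
  by apply: cvgD; [exact: Ck_on_continuous Cf _ Ux|
    exact: Ck_on_continuous Cg _ Ux].
apply: Ck_onSP => // [x Ux|v].
  by apply: cvgD; [exact: Ck_on_continuous Cf _ Ux|
    exact: Ck_on_continuous Cg _ Ux].
exists (fun x => 'D_v f x + 'D_v g x) => [x Ux|].
  by apply: is_deriveD; [exact: Ck_onS_is_derive Cf Ux|
    exact: Ck_onS_is_derive Cg Ux].
by apply: ih; [exact: (Cf.2 v).2|exact: (Cg.2 v).2].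
Qed.

Lemma Ck_on_linear k (L : {linear W -> W'}) (f : V -> W) : continuous L ->
  Ck_on k U f -> Ck_on k U (fun x => L (f x)).
Proof.
move=> Lc.
have Lfc k' (g : V -> W) : Ck_on k' U g -> forall x, U x ->
    {for x, continuous (fun x => L (g x))}.
  move=> Cg x Ux; apply: continuous_comp; last exact: Lc.
  exact: Ck_on_continuous Cg _ Ux.
elim: k f => [|k ih] f Cf; first by split=> //; exact: Lfc Cf.
apply: Ck_onSP => // [|v]; first exact: Lfc Cf.
exists (fun x => L ('D_v f x)); last exact/ih/(Cf.2 v).2.
by move=> x Ux; apply: is_derive_linear => //; exact: Ck_onS_is_derive Cf Ux.
Qed.

End Ck_operations.

Section Ck_products.
Context {R : realType} {V : normedModType R} (U : set V) (oU : open U).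

Lemma Ck_onZ k (W : normedModType R) (f : V -> R) (g : V -> W) :
  Ck_on k U f -> Ck_on k U g -> Ck_on k U (fun x => f x *: g x).
Proof.
have fgc k' (f' : V -> R) (g' : V -> W) : Ck_on k' U f' -> Ck_on k' U g' ->
    forall x, U x -> {for x, continuous (fun x => f' x *: g' x)}.
  move=> Cf Cg x Ux.
  by apply: cvgZ; [exact: Ck_on_continuous Cf _ Ux|
    exact: Ck_on_continuous Cg _ Ux].
elim: k f g => [|k ih] f g Cf Cg; first by split=> //; exact: fgc Cf Cg.
apply: Ck_onSP => // [|v]; first exact: fgc Cf Cg.
exists (fun x => f x *: 'D_v g x + 'D_v f x *: g x) => [x Ux|].
  by apply: is_derive_scale; [exact: Ck_onS_is_derive Cf Ux|
    exact: Ck_onS_is_derive Cg Ux].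
apply: Ck_onD => //; apply: ih.
- exact: Ck_onW.
- exact: (Cg.2 v).2.
- exact: (Cf.2 v).2.
- exact: Ck_onW.
Qed.

(** The derivative [- f^-2 * 'D_v f] involves [f] only through [f^-1], which is C^k by induction;
    nested scalings bring it under [Ck_onZ]. *)
Lemma Ck_onV k (f : V -> R) : (forall x, U x -> f x != 0) ->
  Ck_on k U f -> Ck_on k U (fun x => (f x)^-1).
Proof.
move=> f0.
have fc k' : Ck_on k' U f -> forall x, U x ->
  {for x, continuous (fun x => (f x)^-1)}.
  by move=> Cf x Ux; apply: cvgV; [exact: f0|exact: Ck_on_continuous Cf _ Ux].
elim: k => [|k ih] Cf; first by split=> //; exact: fc Cf.
apply: Ck_onSP => // [|v]; first exact: fc Cf.
have Cfk := ih (Ck_onW Cf).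
exists (fun x => (f x)^-1 *: ((f x)^-1 *: (-1 *: 'D_v f x))) => [x Ux|].
  have [fx _] := Ck_onS_is_derive v Cf Ux.
  apply: DeriveDef; first exact: derivableV (f0 _ Ux) fx.
  rewrite (deriveV (f0 _ Ux) fx) scaleN1r !scalerN scalerA scaleNr.
  by rewrite expr2 invfM.
do 3! apply: Ck_onZ => //; first exact: Ck_on_cst.
exact: (Cf.2 v).2.
Qed.

End Ck_products.

(** * Smooth maps on a surface and the rules for their differentials *)

Section surface.
Context {R : realType} {S : orientedSurface R}.

Lemma smooth_cst (W : normedModType R) (w : W) : smooth (fun _ : S => w).
Proof. by move=> c _ k; apply: Ck_on_cst; exact: cod_open. Qed.

Lemma smoothD (W : normedModType R) (f g : S -> W) : smooth f -> smooth g ->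
  smooth (fun p => f p + g p).
Proof.
by move=> Sf Sg c Ac k; apply: Ck_onD; [exact: cod_open|exact: Sf|exact: Sg].
Qed.

Lemma smoothZ (W : normedModType R) (f : S -> R) (g : S -> W) :
  smooth f -> smooth g -> smooth (fun p => f p *: g p).
Proof.
by move=> Sf Sg c Ac k; apply: Ck_onZ; [exact: cod_open|exact: Sf|exact: Sg].
Qed.

Lemma smoothV (f : S -> R) : (forall p, f p != 0) -> smooth f ->
  smooth (fun p => (f p)^-1).
Proof.
move=> f0 Sf c Ac k; apply: Ck_onV; [exact: cod_open|by move=> *; exact: f0|].
exact: Sf.
Qed.

Lemma smooth_linear (W W' : normedModType R) (L : {linear W -> W'})
  (f : S -> W) : continuous L -> smooth f -> smooth (fun p => L (f p)).
Proof.
by move=> Lc Sf c Ac k; apply: Ck_on_linear => //; [exact: cod_open|exact: Sf].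
Qed.

(** The chart presenting [v] lies in the atlas, so smoothness at order one applies in it. The rules
    for [dmap] of sums, multiples, inverses and linear images are read off from this. *)
Lemma is_derive_dmap (W : normedModType R) (f : S -> W) (v : tvec S) :
  smooth f -> is_derive (tpoint v) (tdir v) (f \o bwd (tchart v)) (dmap f v).
Proof.
by move=> Sf; exact: Ck_onS_is_derive (Sf _ (tchart_atlas v) 1%N)
  (tpoint_cod v).
Qed.

Lemma dmap_cst (W : normedModType R) (w : W) (v : tvec S) :
  dmap (fun _ : S => w) v = 0.
Proof. exact: derive_cst. Qed.

Lemma dmapD (W : normedModType R) (f g : S -> W) (v : tvec S) :
  smooth f -> smooth g -> dmap (fun p => f p + g p) v = dmap f v + dmap g v.
Proof.
move=> Sf Sg; apply: derive_val.
by apply: is_deriveD; exact: is_derive_dmap.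
Qed.

Lemma dmapZ (W : normedModType R) (f : S -> R) (g : S -> W) (v : tvec S) :
  smooth f -> smooth g ->
  dmap (fun p => f p *: g p) v =
  f (foot v) *: dmap g v + dmap f v *: g (foot v).
Proof.
move=> Sf Sg; apply: derive_val.
by apply: is_derive_scale; exact: is_derive_dmap.
Qed.

Lemma dmapV (f : S -> R) (v : tvec S) : (forall p, f p != 0) -> smooth f ->
  dmap (fun p => (f p)^-1) v = - (f (foot v)) ^- 2 * dmap f v.
Proof. by move=> f0 Sf; apply: deriveV => //; case: (is_derive_dmap v Sf). Qed.

Lemma dmap_linear (W W' : normedModType R) (L : {linear W -> W'})
  (f : S -> W) (v : tvec S) : continuous L -> smooth f ->
  dmap (fun p => L (f p)) v = L (dmap f v).
Proof.
move=> Lc Sf; apply: derive_val.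
by apply: is_derive_linear => //; exact: is_derive_dmap.
Qed.

End surface.

(** * Coordinates and the spatial inclusion as continuous linear maps *)

Section linear_maps.
Context {R : realType}.

Definition entry (i : 'I_3) (u : 'rV[R]_3) : R := u 0 i.

Let entry_is_linear i : linear (entry i).
Proof. by move=> k u w; rewrite /entry !mxE. Qed.
HB.instance Definition _ i :=
  GRing.isLinear.Build R 'rV[R]_3 R *:%R (entry i) (entry_is_linear i).

(** The linear part of the affine map [null_lift] below. *)
Definition spatial (u : 'rV[R]_3) : L4 R := (0, u).

Let spatial_is_linear : linear spatial.
Proof.
by move=> k u w; rewrite /spatial; congr (_, _); rewrite /= scaler0 addr0.
Qed.
HB.instance Definition _ :=
  GRing.isLinear.Build R 'rV[R]_3 (L4 R) *:%R spatial spatial_is_linear.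

Lemma entry_continuous i : continuous (entry i).
Proof. exact: coord_continuous. Qed.

Lemma spatial_continuous : continuous spatial.
Proof.
move=> u.
have h := @cvg_pair _ _ _ (nbhs u) (nbhs (0 : R)) (nbhs u)
  _ _ _ (fun=> 0) id (cvg_cst _) cvg_id.
exact: h.
Qed.

End linear_maps.

(** * Bilinearity and differentiation of the Euclidean inner product *)

Section dot.
Context {R : realType}.
Implicit Types (u v w : 'rV[R]_3) (a : R).

Lemma dotC u v : dot u v = dot v u.
Proof. by apply: eq_bigr => i _; rewrite mulrC. Qed.

Lemma dotDl u v w : dot (u + v) w = dot u w + dot v w.
Proof. by rewrite /dot -big_split; apply: eq_bigr => i _;
  rewrite mxE mulrDl. Qed.

Lemma dotZl a u v : dot (a *: u) v = a * dot u v.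
Proof. by rewrite /dot mulr_sumr; apply: eq_bigr => i _; rewrite mxE mulrA. Qed.

Lemma dotDr u v w : dot w (u + v) = dot w u + dot w v.
Proof. by rewrite ![dot w _]dotC dotDl. Qed.

Lemma dotZr a u v : dot v (a *: u) = a * dot v u.
Proof. by rewrite ![dot v _]dotC dotZl. Qed.

Context {S : orientedSurface R}.
Implicit Types f g : S -> 'rV[R]_3.

(** Products are written as scalings of linear images, so that smoothness and the Leibniz rule for
    [dot] follow from those for sums, scalings and linear maps. *)
Let dotE f g : (fun p => dot (f p) (g p)) = fun p =>
  entry ord0 (f p) *: entry ord0 (g p) +
  (entry (inord 1) (f p) *: entry (inord 1) (g p) +
   entry (inord 2) (f p) *: entry (inord 2) (g p)).
Proof.
apply/funext => p; rewrite /dot !big_ord_recl big_ord0 addr0 /entry.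
have -> : lift ord0 ord0 = inord 1 :> 'I_3 by apply/ord_inj; rewrite inordK.
by have -> : lift ord0 (lift ord0 ord0) = inord 2 :> 'I_3
  by apply/ord_inj; rewrite inordK.
Qed.

Lemma smooth_dot f g : smooth f -> smooth g ->
  smooth (fun p => dot (f p) (g p)).
Proof.
move=> Sf Sg; rewrite dotE.
have SE i (h : S -> 'rV[R]_3) : smooth h -> smooth (fun p => entry i (h p)).
  by move=> Sh; apply: (@smooth_linear R S _ _ (entry i)) Sh;
    exact: entry_continuous.
by do ?apply: smoothD; apply: smoothZ; exact: SE.
Qed.

Lemma dmap_dot f g (v : tvec S) : smooth f -> smooth g ->
  dmap (fun p => dot (f p) (g p)) v =
  dot (dmap f v) (g (foot v)) + dot (f (foot v)) (dmap g v).
Proof.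
move=> Sf Sg; rewrite dotE.
have SE i (h : S -> 'rV[R]_3) : smooth h -> smooth (fun p => entry i (h p)).
  by move=> Sh; apply: (@smooth_linear R S _ _ (entry i)) Sh;
    exact: entry_continuous.
have SM i : smooth (fun p => entry i (f p) *: entry i (g p)).
  by apply: smoothZ; exact: SE.
rewrite !dmapD //; last exact: smoothD.
rewrite !dmapZ; do ?exact: SE.
have dmapE i (h : S -> 'rV[R]_3) : smooth h ->
    dmap (fun p => entry i (h p)) v = entry i (dmap h v).
  by move=> Sh; apply: (@dmap_linear R S _ _ (entry i)) Sh;
    exact: entry_continuous.
rewrite !dmapE //.
(* The expansion for two vectors is [dotE] for constant maps, evaluated at a point. *)
have dE (u w : 'rV[R]_3) : dot u w = entry ord0 u *: entry ord0 w +
    (entry (inord 1) u *: entry (inord 1) w +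
     entry (inord 2) u *: entry (inord 2) w).
  by have /(congr1 (@^~ (foot v))) := dotE (fun=> u) (fun=> w).
rewrite !dE /GRing.scale /=; ring.
Qed.

End dot.

(** * Differentials of unit normals and the data of the swapped pair *)

Lemma dmap_unit_orth (R : realType) (S : orientedSurface R)
    (N : S -> 'rV[R]_3) (v : tvec S) : smooth N ->
  (forall p, dot (N p) (N p) = 1) -> dot (dmap N v) (N (foot v)) = 0.
Proof.
move=> SN N1; have := dmap_dot v SN SN.
rewrite (_ : (fun p => _) = fun=> 1); last exact/funext.
rewrite dmap_cst [X in _ + X]dotC => /esym/eqP.
by rewrite -mulr2n mulrn_eq0 => /eqP.
Qed.

(** The new frontal [w] is minus the inversion of [XZ] in the unit sphere. Since |w|^2 = 1/q, also
    [XZ] is - w / |w|^2, so the relation between the two sides is symmetric. *)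
Lemma ribaucour_data_swap (R : realType) (S : orientedSurface R)
    (Z N Zt Nt XZ : S -> 'rV[R]_3) (rho phi : S -> R) :
  frontal Z N -> frontal Zt Nt -> ribaucour_data Z N Zt Nt rho phi XZ ->
  ribaucour_data Zt Nt Z N (fun p => rho p / dot (XZ p) (XZ p))
    (fun p => phi p / dot (XZ p) (XZ p))
    (fun p => - (dot (XZ p) (XZ p))^-1 *: XZ p).
Proof.
move=> [SZ SN N1 _] [_ SNt Nt1 _].
move=> [[Srho Sphi] rho0 [SX _ _ dXN] [rhoE drho dphi] [ZtE NtE]].
pose q p := dot (XZ p) (XZ p).
have q0 p : q p != 0.
  apply: contra (rho0 p) => /eqP/dot_eq0 X0.
  by rewrite rhoE X0 -(scale0r (0 : 'rV_3)) dotZl mul0r.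
have Sq : smooth q by exact: smooth_dot.
have SqV : smooth (fun p => (q p)^-1) by exact: smoothV.
pose w p := - (q p)^-1 *: XZ p.
have Sw : smooth w.
  apply: smoothZ => //.
  by under eq_fun do rewrite -mulN1r; apply: (smoothZ (W := R)) => //;
    exact: smooth_cst.
have Srhot : smooth (fun p => rho p / q p) by exact: (smoothZ (W := R)).
have Sphit : smooth (fun p => phi p / q p) by exact: (smoothZ (W := R)).
have ww p : dot (w p) (w p) = (q p)^-1.
  by rewrite dotZl dotZr -/(q p); field; exact: q0.
have Ntw p : Nt p = N p + (2 * rho p) *: w p.
  by rewrite NtE scalerA mulrN scaleNr.
have Ztw p : Zt p = Z p + (2 * phi p) *: w p.
  by rewrite ZtE scalerA mulrN scaleNr.
have dq v : dmap q v = 2 * dot (XZ (foot v)) (dmap XZ v).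
  by rewrite dmap_dot // [dot (dmap _ _) _]dotC; ring.
(* Here <w, N> = - rho / q, and the term 2 rho w of [Nt] adds 2 rho / q. *)
have rhotE p : rho p / q p = dot (w p) (Nt p).
  rewrite Ntw dotDr [dot _ (_ *: _)]dotZr ww [dot (w p) _]dotZl -rhoE.
  by field; exact: q0.
have qV v : dmap (fun p => (q p)^-1) v = - (q (foot v)) ^- 2 * dmap q v.
  exact: dmapV.
have dw v : dmap w v = - (q (foot v))^-1 *: dmap XZ v +
    ((q (foot v)) ^- 2 * dmap q v) *: XZ (foot v).
  rewrite (_ : w = fun p => (q p)^-1 *: (- 1 *: XZ p)); last first.
    by apply/funext => p; rewrite scalerA mulrN1.
  have S1 : smooth (fun p => -1 *: XZ p).
    by apply: smoothZ => //; exact: smooth_cst.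
  rewrite dmapZ // dmapZ //; last exact: smooth_cst.
  by rewrite dmap_cst scale0r addr0 qV !scalerA mulrN1 mulNr mulrN1 opprK.
(* As <dXZ, N> = 0, <dw, N> is rho dq / q^2; it cancels against 2 rho <dw, w> = rho d(1/q). *)
have dwNt v : dot (dmap w v) (Nt (foot v)) = 0.
  rewrite dw Ntw !(dotDl, dotDr, dotZl, dotZr) -/(q _).
  rewrite dXN -rhoE dq [dot (dmap XZ v) _]dotC.
  by field; exact: q0.
split=> //; first by move=> p; rewrite mulf_neq0 ?invr_eq0 //; exact: q0.
- split=> // v.
    rewrite (_ : (fun p => _) = fun p => dot (w p) (Nt p)); last exact/funext.
    by rewrite dmap_dot // dwNt add0r.
  have -> : Zt = fun p => Z p + (2 * phi p) *: w p by exact/funext.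
  have S2 : smooth (fun p => 2 * phi p).
    by apply: (smoothZ (W := R)) => //; exact: smooth_cst.
  (* With phi / q written as phi |w|^2 and <w, dZ> = - dphi / q, both sides become dphi / q + 2 phi
     <w, dw>. *)
  have -> : (fun p => phi p / dot (XZ p) (XZ p)) =
      fun p => phi p *: dot (w p) (w p).
    by apply/funext => p; rewrite ww.
  rewrite dmapZ //; last exact: smooth_dot.
  rewrite dmapD //; last exact: smoothZ.
  rewrite (dmapZ v S2 Sw) (dmapZ (W := R) (f := fun=> 2)) //;
    last exact: smooth_cst.
  rewrite dmap_cst scale0r addr0.
  rewrite dmap_dot // !(dotDl, dotDr, dotZl, dotZr) -dphi -/(q _).
  rewrite [dot (dmap w v) _]dotC /GRing.scale /=.
  by field; exact: q0.
(* Division by |w|^2 = 1/q turns phi / q and rho / q back into phi and rho, so the terms added to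
   [Z] and [N] are subtracted again. *)
- by split=> p; rewrite -/(q p) -/(w p) ww ?Ztw ?Ntw invrK mulrA divfK // addrK.
Qed.

(** * Lifts of unit vectors to the light cone *)

Section null_lift.
Context {R : realType}.

(** For unit [n], the point of height one on the null line that represents [n] in the sphere at
    infinity. *)
Definition null_lift (n : 'rV[R]_3) : L4 R := (1, n).

Let liftE (S : orientedSurface R) (N : S -> 'rV[R]_3) :
  (fun p => null_lift (N p)) = fun p => (1, 0) + spatial (N p).
Proof.
by apply/funext => p; rewrite /null_lift /spatial; congr (_, _);
  rewrite /= ?addr0 ?add0r.
Qed.

Context {S : orientedSurface R}.
Implicit Types N : S -> 'rV[R]_3.

Lemma smooth_spatial N : smooth N -> smooth (fun p => spatial (N p)).
Proof.
move=> SN; apply: (@smooth_linear R S _ _ spatial) SN;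
  exact: spatial_continuous.
Qed.

Lemma smooth_null_lift N : smooth N -> smooth (fun p => null_lift (N p)).
Proof.
by move=> SN; rewrite liftE; apply: smoothD; [exact: smooth_cst|
  exact: smooth_spatial].
Qed.

Lemma dmap_null_lift N (v : tvec S) :
  smooth N -> dmap (fun p => null_lift (N p)) v = spatial (dmap N v).
Proof.
move=> SN; rewrite liftE (dmapD v (smooth_cst _) (smooth_spatial SN)).
rewrite dmap_cst add0r; apply: (@dmap_linear R S _ _ spatial) SN.
exact: spatial_continuous.
Qed.

End null_lift.

(** * The hyperbolic frontal and its normal as combinations of two null lifts *)

Section hyperbolic_frontal.
Context {R : realType} {S : orientedSurface R}.
Variables (N Nt : S -> 'rV[R]_3) (rho rhot : S -> R).
Hypotheses (SN : smooth N) (SNt : smooth Nt).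
Hypotheses (N1 : forall p, dot (N p) (N p) = 1).
Hypotheses (Nt1 : forall p, dot (Nt p) (Nt p) = 1).
Hypotheses (Srho : smooth rho) (Srhot : smooth rhot).
Hypotheses (rho0 : forall p, rho p != 0) (rhot0 : forall p, rhot p != 0).
Hypothesis NNt : forall p, dot (N p) (Nt p) = 1 - 2 * rho p * rhot p.

(** Half of the multiple - 1 / r, since X and Nu are the half sum and half difference of the two
    scaled null lifts. *)
Let coef (r : S -> R) p : R := - 2^-1 * (r p)^-1.

(** The sign [e] is 1 for X and -1 for Nu, so that one computation yields all their Lorentz
    products. *)
Definition hyp_comb (e : R) (p : S) : L4 R :=
  coef rho p *: null_lift (N p) + (e * coef rhot p) *: null_lift (Nt p).

Let smooth_coef r : smooth r -> (forall p, r p != 0) -> smooth (coef r).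
Proof.
move=> Sr r0; apply: (smoothZ (W := R)); first exact: smooth_cst.
exact: smoothV.
Qed.

Let dmap_coef r (v : tvec S) : smooth r -> (forall p, r p != 0) ->
  dmap (coef r) v = 2^-1 * (r (foot v)) ^- 2 * dmap r v.
Proof.
move=> Sr r0.
have := dmapZ (W := R) v (smooth_cst (- 2^-1 : R)) (smoothV r0 Sr).
rewrite dmap_cst scale0r addr0 dmapV // => ->.
by rewrite /GRing.scale /=; ring.
Qed.

Let smooth_ecoef e : smooth (fun p => e * coef rhot p).
Proof. by apply: (smoothZ (W := R)); [exact: smooth_cst|
  exact: smooth_coef]. Qed.

Let smooth_comb e : smooth (hyp_comb e).
Proof.
apply: smoothD; apply: smoothZ; do ?exact: smooth_null_lift;
  last exact: smooth_ecoef.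
exact: smooth_coef.
Qed.

Let dmap_comb (v : tvec S) : dmap (hyp_comb 1) v =
  (coef rho (foot v) *: spatial (dmap N v) +
   dmap (coef rho) v *: null_lift (N (foot v))) +
  (coef rhot (foot v) *: spatial (dmap Nt v) +
   dmap (coef rhot) v *: null_lift (Nt (foot v))).
Proof.
have Sc := smooth_coef Srho rho0; have Sct := smooth_coef Srhot rhot0.
have SL := smooth_null_lift SN; have SLt := smooth_null_lift SNt.
have -> : hyp_comb 1 = fun p =>
    coef rho p *: null_lift (N p) + coef rhot p *: null_lift (Nt p).
  by apply/funext => p; rewrite /hyp_comb mul1r.
rewrite dmapD; [|exact: smoothZ..].
by rewrite (dmapZ v Sc SL) (dmapZ v Sct SLt) !dmap_null_lift.
Qed.

Lemma hyp_frontal_comb :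
  (forall v : tvec S,
    dot (dmap N v) (Nt (foot v)) = - 2 * rhot (foot v) * dmap rho v) ->
  (forall v : tvec S,
    dot (dmap Nt v) (N (foot v)) = - 2 * rho (foot v) * dmap rhot v) ->
  hyp_frontal (hyp_comb 1) (hyp_comb (-1)).
Proof.
move=> dNNt dNtN.
(* Both lifts are null, so only the mixed product <N, Nt> - 1 = - 2 rho rhot survives, with
   coefficient (e + f) / (4 rho rhot). *)
have lorentzE e f p : lorentz (hyp_comb e p) (hyp_comb f p) = - ((e + f) / 2).
  rewrite /lorentz /hyp_comb /coef /= !(dotDl, dotDr, dotZl, dotZr).
  rewrite [dot (Nt p) (N p)]dotC N1 Nt1 NNt /GRing.scale /=.
  by field; rewrite rho0 rhot0.
split.
- by split; exact: smooth_comb.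
- by move=> p; rewrite lorentzE; field.
- by move=> p; rewrite lorentzE; field.
- by move=> p; rewrite lorentzE; field.
(* The term with <dN, Nt> gives drho / (2 rho), which the derivative of the first coefficient
   cancels; the [rhot] terms cancel likewise with opposite signs. *)
- move=> v; rewrite dmap_comb !dmap_coef // /lorentz /hyp_comb /coef /=.
  rewrite !(dotDl, dotDr, dotZl, dotZr) [dot (Nt _) (N _)]dotC N1 Nt1 NNt.
  rewrite dNNt dNtN !dmap_unit_orth // /GRing.scale /=.
  by field; rewrite rho0 rhot0.
Qed.

End hyperbolic_frontal.

(** * From Ribaucour data to the Gauss maps and associated frontals in hyperbolic space *)

Theorem proposition2p14 (R : realType) (Sigma : orientedSurface R)
    (Sigma_connected : connected [set: Sigma])
    (Z N Zt Nt XZ : Sigma -> 'rV[R]_3) (rho phi : Sigma -> R) :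
  ribaucour_integrable Z N Zt Nt ->
  ribaucour_data Z N Zt Nt rho phi XZ ->
  let rhot := fun p => rho p / dot (XZ p) (XZ p) in
  let phit := fun p => phi p / dot (XZ p) (XZ p) in
  let XZt := fun p => - (rhot p / rho p) *: XZ p in
  ribaucour_data Zt Nt Z N rhot phit XZt /\
  exists X Nu : Sigma -> L4 R,
    [/\ hyp_frontal X Nu,
        associated 1 X Nu =1 XZ /\ associated (-1) X Nu =1 XZt,
        hyp_normal 1 X Nu =1 N /\ hyp_normal (-1) X Nu =1 Nt,
        hyp_gauss 1 X Nu =1 (fun p => stereo (N p)) &
        hyp_gauss (-1) X Nu =1 (fun p => stereo (Nt p))].
Proof.
move=> [FZ FZt _ _ _] dat rhot phit XZt.
have [_ SNt Nt1 _] := FZt.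
have [[Srho _] rho0 [_ SN N1 _] [rhoE drho _] [_ NtE]] := dat.
have XX0 p : dot (XZ p) (XZ p) != 0.
  apply: contra (rho0 p) => /eqP/dot_eq0 X0.
  by rewrite rhoE X0 -(scale0r (0 : 'rV_3)) dotZl mul0r.
have XZtE : XZt = fun p => - (dot (XZ p) (XZ p))^-1 *: XZ p.
  by apply/funext => p; rewrite /XZt /rhot mulrAC divff // mul1r.
have datt : ribaucour_data Zt Nt Z N rhot phit XZt.
  by rewrite XZtE; exact: ribaucour_data_swap.
split=> //.
have [[Srhot _] rhot0 _ [_ drhot _] [_ NE]] := datt.
(* Pairing [Nt] with [N] gives 1 - 2 rho <XZ, N> / q, where <XZ, N> = rho and rho / q = rhot. *)
have NNt p : dot (N p) (Nt p) = 1 - 2 * rho p * rhot p.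
  rewrite NtE -scaleNr dotDr dotZr N1 [dot (N p) _]dotC -rhoE /rhot.
  by field; exact: XX0.
pose X := hyp_comb N Nt rho rhot 1; pose Nu := hyp_comb N Nt rho rhot (-1).
(* In the sum the [Nt] terms cancel and the halves at [N] add up; in [minus] the roles are
   exchanged. *)
have plus p : ((X p).1 + 1 * (Nu p).1 = - (rho p)^-1) *
    ((X p).2 + 1 *: (Nu p).2 = - (rho p)^-1 *: N p).
  split; first by rewrite /= /GRing.scale /=; field; rewrite rho0 rhot0.
  by apply/rowP => i; rewrite !mxE; field; rewrite rho0 rhot0.
have minus p : ((X p).1 + -1 * (Nu p).1 = - (rhot p)^-1) *
    ((X p).2 + -1 *: (Nu p).2 = - (rhot p)^-1 *: Nt p).
  split; first by rewrite /= /GRing.scale /=; field; rewrite rho0 rhot0.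
  by apply/rowP => i; rewrite !mxE; field; rewrite rho0 rhot0.
have nplus : hyp_normal 1 X Nu =1 N.
  by move=> p; rewrite /hyp_normal !plus scalerA mulVf ?scale1r //
    oppr_eq0 invr_eq0.
have nminus : hyp_normal (-1) X Nu =1 Nt.
  by move=> p; rewrite /hyp_normal !minus scalerA mulVf ?scale1r //
    oppr_eq0 invr_eq0.
exists X, Nu; split => //.
(* Both identities pair a differential with Nt = N - 2 rhot XZ or N = Nt - 2 rho XZt: a unit map is
   orthogonal to its own differential, and <XZ, dN> = drho, <XZt, dNt> = drhot. *)
- apply: hyp_frontal_comb => // v.
    rewrite NtE -scaleNr dotDr dotZr dmap_unit_orth // [dot (dmap _ _) _]dotC.
    by rewrite -drho add0r /rhot; field; exact: XX0.
  have -> : N (foot v) = Nt (foot v) + - (2 * rho (foot v)) *: XZt (foot v).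
    by rewrite NtE XZtE scalerA mulrNN subrK.
  rewrite dotDr dotZr dmap_unit_orth // drhot [dot (dmap _ _) _]dotC; ring.
(* With r and x the height and spatial part of X, x - r N = (N - Nt) / (2 rhot) = XZ and x - r Nt =
   (Nt - N) / (2 rho) = - XZ / q. *)
- split=> p; apply/rowP => i; rewrite /associated.
    rewrite !plus /= !mxE NtE !mxE /rhot /GRing.scale /=.
    by field; rewrite rho0 XX0.
  rewrite !minus /= !mxE NtE !mxE /rhot /GRing.scale /=.
  by field; rewrite rho0 XX0.
- by move=> p; rewrite /hyp_gauss nplus.
- by move=> p; rewrite /hyp_gauss nminus.
Qed.
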